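(* Let $G=(V,E)$ be a finite connected simple graph with $n$ vertices and maximum degree $\Delta$, let $\mathbf{D}$ be an unweighted deterministic walk on $G$ with parameter $\tilde\kappa$, and let $\mathbf{D}'$ be the corresponding symmetric deterministic walk, which corresponds to the symmetric random walk $\mathbf{P}'$. Then for every vertex $v\in V$, \[ K'(v)=O\Big(\max_{u\in V}\mathsf{H}'(u,v)+\frac{\tilde\kappa}{\pi'_v}\Psi(\mathbf{P}',v)+n\,\Delta\,\tilde\kappa\Big), \] with an absolute implied constant.
   Context: Unweighted deterministic walk $\mathbf{D}$: each vertex $u$ has a rotor sequence $(\tilde s(u,1),\dots,\tilde s(u,\tilde d(u)))$ of neighbours of $u$ in which every neighbour occurs exactly $\tilde d(u)/\deg(u)$ times; $\tilde\kappa=\max_u\tilde d(u)/\deg(u)$. Symmetric random walk: $\mathbf{P}'_{u,v}=\frac1{\Delta+1}$ if $\{u,v\}\in E$, $\mathbf{P}'_{u,u}=1-\frac{\deg(u)}{\Delta+1}$, and $0$ otherwise; it is the weighted walk with weights $c'(u,v)=1$ on edges and $c'(u,u)=\Delta+1-\deg(u)$, and its stationary distribution is $\pi'_u=1/n$. The corresponding symmetric deterministic walk $\mathbf{D}'$ has rotor sequences of length $\tilde d'(u)=\frac{\Delta+1}{\deg(u)}\tilde d(u)$ with $\tilde s'(u,i)=\tilde s(u,i)$ for $i\le\tilde d(u)$ and $\tilde s'(u,i)=u$ for $i>\tilde d(u)$. $\mathsf{H}'(u,v)$ is the expected hitting time of $v$ from $u$ under $\mathbf{P}'$. $K'(v)$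 is defined for $\mathbf{P}',\mathbf{D}'$ as \[ K'(v)=\max_{u}\mathsf{H}'(u,v)+\frac12\Big(\frac{\tilde d'(v)}{\pi'_v}+\sum_{i,j\in V}\tilde d'(i)\mathbf{P}'_{i,j}\big|\mathsf{H}'(i,v)-\mathsf{H}'(j,v)-1\big|\Big), \] and $\Psi(\mathbf{P}',v)=\sum_{t\ge0}\sum_{\{i,j\}\in E}|\mathbf{P}'^t_{i,v}-\mathbf{P}'^t_{j,v}|$. *)

(* Defs.v *)
From HB Require Import structures.
From mathcomp Require Import all_boot all_order all_algebra.
From mathcomp Require Import all_classical all_reals all_analysis.

Set Implicit Arguments.
Unset Strict Implicit.
Unset Printing Implicit Defensive.

Import Order.TTheory GRing.Theory Num.Theory.

Local Open Scope ring_scope.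

Section Graph.
Variables (n : nat) (e : rel 'I_n).

Definition connected_graph : Prop := forall u v : 'I_n, connect e u v.

Definition deg (u : 'I_n) : nat := #|[set w | e u w]|.

Definition max_deg : nat := \max_(u < n) deg u.

(* [s u] is the rotor sequence of [u], of length [size (s u)]; the second
   clause says that every neighbour occurs [size (s u) / deg u] times.  A
   vertex without neighbours (which a connected graph has only if it has a
   single vertex) gets the empty sequence. *)
Definition unweighted_rotor (s : 'I_n -> seq 'I_n) : Prop :=
  forall u : 'I_n,
    [/\ {in s u, forall w, e u w},
        forall w, e u w -> (count_mem w (s u) * deg u = size (s u))%N
      & (0 < deg u)%N -> (0 < size (s u))%N].

(* The division is exact when [s] is an unweighted rotor, because [deg u] then
   divides [size (s u)]. *)
Definition sym_rotor_length (s : 'I_n -> seq 'I_n) (u : 'I_n) : nat :=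
  ((max_deg.+1 * size (s u)) %/ deg u)%N.

Definition sym_rotor (s : 'I_n -> seq 'I_n) (u : 'I_n) : seq 'I_n :=
  s u ++ nseq (sym_rotor_length s u - size (s u)) u.

End Graph.

Section Walk.
Variables (R : realType) (n : nat).

Definition rotor_kappa (e : rel 'I_n) (s : 'I_n -> seq 'I_n) : R :=
  \big[Num.max/0]_(u < n) ((size (s u))%:R / (deg e u)%:R).

Definition sym_walk (e : rel 'I_n) : 'M[R]_n :=
  \matrix_(u, w)
    if e u w then (max_deg e).+1%:R^-1
    else if u == w then 1 - (deg e u)%:R / (max_deg e).+1%:R
    else 0.

Definition sym_stationary (u : 'I_n) : R := n%:R^-1.

(* Probability that the chain with transition matrix [P] started at [u]
   follows the states of [s] in its first [size s] steps. *)
Fixpoint traj_prob (P : 'M[R]_n) (u : 'I_n) (s : seq 'I_n) : R :=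
  if s is w :: s' then P u w * traj_prob P w s' else 1.

(* Probability that the first visit to [v], time 0 included, is at time [t]:
   [index v (u :: s)] is the first position of [v] in [u :: s], and it is
   [t.+1] when [v] does not occur. *)
Definition hit_prob (P : 'M[R]_n) (u v : 'I_n) (t : nat) : R :=
  \sum_(s : t.-tuple 'I_n | index v (u :: s) == t) traj_prob P u s.

(* Expectation of the first visit time, a random variable with values in
   {0, 1, ...} and +oo; the last term is +oo times the probability that [v] is
   never visited (with +oo * 0 = 0).  In particular [hitting_time P v v = 0]. *)
Definition hitting_time (P : 'M[R]_n) (u v : 'I_n) : \bar R :=
  (\sum_(0 <= t <oo) (t%:R * hit_prob P u v t)%:E
   + +oo * (1 - \sum_(0 <= t <oo) (hit_prob P u v t)%:E))%E.

Definition max_hitting_time (P : 'M[R]_n) (v : 'I_n) : \bar R :=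
  \big[maxe/-oo%E]_(u < n) hitting_time P u v.

Definition walk_K (P : 'M[R]_n) (pi : 'I_n -> R) (d : 'I_n -> nat)
    (v : 'I_n) : \bar R :=
  (max_hitting_time P v
   + (2^-1)%:E * (((d v)%:R / pi v)%:E
       + \sum_(i < n) \sum_(j < n)
           ((d i)%:R * P i j)%:E
           * `|hitting_time P i v - hitting_time P j v - 1|))%E.

(* Each unordered edge is counted once, as the pair with [i < j]. *)
Definition walk_Psi (e : rel 'I_n) (P : 'M[R]_n) (v : 'I_n) : \bar R :=
  (\sum_(0 <= t <oo)
     (\sum_(i < n) \sum_(j < n | (i < j)%N && e i j)
        `|(P ^+ t) i v - (P ^+ t) j v|)%:E)%E.

End Walk.

(* Main.v *)
(* Let h be the vector of hitting times of v and N the number of vertices.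
   Symmetry of P makes the expected return time to v equal to N, so h solves
   P h = h - 1 + N e_v and, iterating,
     h_i - h_j = (P^T h)_i - (P^T h)_j - N sum_(t < T) (P^t_(i,v) - P^t_(j,v)).
   P is lazy, so |f|^2 - |P f|^2 controls (f_i - f_j)^2 along the edges; these
   decrements telescope along f = P^T h, hence the first difference tends to 0
   and sum_(edges) |h_i - h_j| <= N Psi.  The rest of K' is at most a constant
   times N Delta kappa.  If kappa = 0 then all rotor lengths vanish, and if a
   hitting time or Psi is infinite then so is the right-hand side. *)

Require Import Defs.
From HB Require Import structures.
From mathcomp Require Import all_boot all_order all_algebra.
From mathcomp Require Import all_classical all_reals all_analysis.
From mathcomp Require Import ring lra.

Set Implicit Arguments.
Unset Strict Implicit.
Unset Printing Implicit Defensive.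

Import Order.TTheory GRing.Theory Num.Theory.

Local Open Scope ring_scope.

(** * First-step analysis of hitting times for a stochastic matrix *)

Section HittingTime.
Variables (R : realType) (n : nat) (P : 'M[R]_n).
Hypothesis P_ge0 : forall i j, 0 <= P i j.
Hypothesis P_sum1 : forall i, \sum_j P i j = 1.

Lemma traj_prob_ge0 u s : 0 <= traj_prob P u s.
Proof. by elim: s u => //= w s IH u; rewrite mulr_ge0. Qed.

Lemma hit_prob_ge0 u v t : 0 <= hit_prob P u v t.
Proof. by apply: sumr_ge0 => s _; exact: traj_prob_ge0. Qed.

Lemma hit_prob0 u v : hit_prob P u v 0 = (u == v)%:R.
Proof.
rewrite /hit_prob big_mkcond (big_pred1 [tuple]) => [|s]; last first.
  by apply/esym/eqP; rewrite (tuple0 s).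
by rewrite /=; case: (u == v).
Qed.

(** A path of length [t.+1] is a first state [w] followed by a path of length [t]; since [u != v],
    dropping [u] lowers the index of [v] by one. *)
Lemma hit_probS u v t : u != v ->
  hit_prob P u v t.+1 = \sum_w P u w * hit_prob P w v t.
Proof.
move=> uv; rewrite /hit_prob.
under [RHS]eq_bigr do rewrite mulr_sumr.
rewrite pair_big_dep /=.
pose f (p : 'I_n * t.-tuple 'I_n) : t.+1.-tuple 'I_n := [tuple of p.1 :: p.2].
rewrite (reindex f) /=; last first.
  exists (fun s : t.+1.-tuple 'I_n => (thead s, [tuple of behead s]))
    => [[w s] _|s _].
    by rewrite /f /= theadE; congr pair; apply: val_inj.
  by rewrite /f /= [RHS]tuple_eta; apply: val_inj.
by apply: eq_bigl => -[w s] /=; rewrite (negbTE uv).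
Qed.

Lemma hit_prob_refl v t : hit_prob P v v t.+1 = 0.
Proof. by rewrite /hit_prob big1// => s; rewrite /= eqxx. Qed.

(** First visits at different times are disjoint events; induction along the first step shows this
    without a measure on infinite paths. *)
Lemma sum_hit_prob_le1 T u v : \sum_(0 <= t < T) hit_prob P u v t <= 1.
Proof.
elim: T u => [|T IH] u; first by rewrite big_geq.
rewrite big_nat_recl// hit_prob0.
have [->|uv] := eqVneq u v.
  by rewrite big1 ?addr0// => t _; exact: hit_prob_refl.
rewrite add0r; under eq_bigr do rewrite hit_probS//.
rewrite exchange_big /= -(P_sum1 u); apply: ler_sum => w _.
by rewrite -mulr_sumr ler_piMr.
Qed.

Local Open Scope ereal_scope.

Let mean_hit u v := \sum_(0 <= t <oo) (t%:R * hit_prob P u v t)%:E.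
Let total_hit u v := \sum_(0 <= t <oo) (hit_prob P u v t)%:E.

Let mean_hit_ge0 u v : 0 <= mean_hit u v.
Proof.
by apply: nneseries_ge0 => t _ _; rewrite lee_fin mulr_ge0// hit_prob_ge0.
Qed.

Let total_hit_le1 u v : total_hit u v <= 1.
Proof.
apply: lime_le.
  by apply: is_cvg_nneseries => t _ _; rewrite lee_fin hit_prob_ge0.
by apply: nearW => T; rewrite sumEFin lee_fin sum_hit_prob_le1.
Qed.

Let total_hit_fin u v : total_hit u v \is a fin_num.
Proof.
apply/fin_numPlt/andP; split.
  apply: (@lt_le_trans _ _ 0); rewrite ?ltNy0//.
  by apply: nneseries_ge0 => t _ _; rewrite lee_fin hit_prob_ge0.
by apply: (le_lt_trans (total_hit_le1 _ _)); rewrite ltry.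
Qed.

Lemma hitting_time_ge0 u v : 0 <= hitting_time P u v.
Proof.
apply: adde_ge0; first exact: mean_hit_ge0.
apply: mule_ge0; rewrite ?leey// sube_ge0; first exact: total_hit_le1.
by rewrite total_hit_fin ?orbT.
Qed.

(** A defect [total_hit u v < 1] would make the [+oo] term infinite, so a finite hitting time forces
    an almost sure visit. *)
Let hitting_time_fin u v : hitting_time P u v < +oo ->
  hitting_time P u v = mean_hit u v /\ total_hit u v = 1.
Proof.
move=> ltoo; suff tot1 : total_hit u v = 1.
  split => //; rewrite /hitting_time -/(total_hit u v) tot1.
  by rewrite subee// mule0 adde0.
apply/eqP; rewrite eq_le total_hit_le1 leNgt /=; apply/negP => lt1.
move: ltoo; rewrite /hitting_time gt0_mulye ?sube_gt0//.
by rewrite addey ?ltxx// gt_eqF// (lt_le_trans _ (mean_hit_ge0 u v))// ltNy0.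
Qed.

Lemma hitting_time_refl v : hitting_time P v v = 0.
Proof.
have t1 : total_hit v v = 1.
  rewrite /total_hit nneseries_recl//=; last first.
    by move=> t _; rewrite lee_fin hit_prob_ge0.
  rewrite hit_prob0 eqxx eseries0 ?adde0// => -[|t]// _ _.
  by rewrite hit_prob_refl.
rewrite /hitting_time -/(total_hit v v) t1 subee// mule0 adde0.
by apply: eseries0 => -[|t] _ _; rewrite ?mul0r// hit_prob_refl mulr0.
Qed.

Lemma hitting_time_rec u v :
    (forall w, hitting_time P w v < +oo) -> u != v ->
  hitting_time P u v = 1 + \sum_w (P u w)%:E * hitting_time P w v.
Proof.
move=> ltoo uv; rewrite (hitting_time_fin (ltoo u)).1.
(* The summand 1 is the average of [total_hit w v = 1] under [P u]. Both series then agree term by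
   term, because [t.+1] copies of a probability are one copy plus [t] copies. *)
transitivity (\sum_w (P u w)%:E * (total_hit w v + mean_hit w v)); last first.
  under eq_bigr do
    rewrite (hitting_time_fin (ltoo _)).2 -(hitting_time_fin (ltoo _)).1.
  under eq_bigr => w _ do rewrite ge0_muleDr ?hitting_time_ge0//.
  rewrite big_split /=; congr (_ + _).
  by under eq_bigr do rewrite mule1; rewrite sumEFin P_sum1.
rewrite /mean_hit nneseries_recl//=; last first.
  by move=> t _; rewrite lee_fin mulr_ge0// hit_prob_ge0.
rewrite mul0r add0e -(nneseries_addn 1)//; last first.
  by move=> t; rewrite lee_fin mulr_ge0// hit_prob_ge0.
under [RHS]eq_bigr => w _.
  rewrite -nneseriesD//; last 2 first.
  - by move=> t _ _; rewrite lee_fin hit_prob_ge0.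
  - by move=> t _ _; rewrite lee_fin mulr_ge0// hit_prob_ge0.
  rewrite -nneseriesZl//; last first.
    by move=> t _; rewrite -EFinD lee_fin addr_ge0 ?mulr_ge0 ?hit_prob_ge0.
  over.
rewrite -nneseries_sum//=; last first.
  move=> w t _; rewrite -EFinD -EFinM lee_fin mulr_ge0//.
  by rewrite addr_ge0 ?mulr_ge0 ?hit_prob_ge0.
apply: eq_eseriesr => t _; rewrite addn1 hit_probS// sumEFin; congr EFin.
by rewrite mulr_sumr; apply: eq_bigr => w _; rewrite -natr1; ring.
Qed.

End HittingTime.

(** * Symmetric stochastic matrices: energy decay and the Poisson equation of hitting times *)

Section SymmetricChain.
Import numFieldNormedType.Exports.
Variables (R : realType) (n : nat) (P : 'M[R]_n).
Hypothesis P_ge0 : forall i j, 0 <= P i j.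
Hypothesis P_sum1 : forall i, \sum_j P i j = 1.
Hypothesis P_sym : forall i j, P i j = P j i.

(* The decrement is the sum over [k] of the variances of [f] under [P k]. *)
Lemma sqnorm_decrement (d : R) (f : 'cV[R]_n) i j :
    0 <= d -> i != j -> d <= P i i -> d <= P i j ->
  \sum_k (P *m f) k 0 ^+ 2
    <= \sum_k f k 0 ^+ 2 - d / 2 * (f i 0 - f j 0) ^+ 2.
Proof.
move=> d0 ij dii dij.
pose m k := (P *m f) k 0.
pose V k := \sum_l P k l * (f l 0 - m k) ^+ 2.
have V_ge0 k : 0 <= V k by apply: sumr_ge0 => l _; rewrite mulr_ge0// sqr_ge0.
have VE k : V k = \sum_l P k l * f l 0 ^+ 2 - m k ^+ 2.
  have -> : V k = \sum_l (P k l * f l 0 ^+ 2 - 2 * m k * (P k l * f l 0)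
                          + m k ^+ 2 * P k l).
    by apply: eq_bigr => l _; ring.
  rewrite big_split sumrB /= -!mulr_sumr P_sum1.
  have -> : \sum_l P k l * f l 0 = m k by rewrite /m mxE.
  by ring.
(* By symmetry the columns of [P] sum to 1, so averaging the squares keeps their total. *)
have sumV : \sum_k V k = \sum_k f k 0 ^+ 2 - \sum_k m k ^+ 2.
  under eq_bigr do rewrite VE.
  rewrite sumrB exchange_big /=; congr (_ - _); apply: eq_bigr => l _.
  rewrite -mulr_suml; under eq_bigr do rewrite P_sym.
  by rewrite P_sum1 mul1r.
suff : d / 2 * (f i 0 - f j 0) ^+ 2 <= \sum_k V k by rewrite sumV; lra.
apply: (@le_trans _ _ (V i)); last first.
  by rewrite (bigD1 i)//= lerDl sumr_ge0.
rewrite /V (bigD1 i)//= (bigD1 j) 1?eq_sym//= addrA.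
apply: (@le_trans _ _ (d * (f i 0 - m i) ^+ 2 + d * (f j 0 - m i) ^+ 2));
    last first.
  rewrite -[leLHS]addr0; apply: lerD; last first.
    by apply: sumr_ge0 => l _; rewrite mulr_ge0// sqr_ge0.
  by apply: lerD; rewrite ler_wpM2r ?sqr_ge0.
(* With [a] and [b] the deviations of [f i 0] and [f j 0] from [m i], this is [2 a^2 + 2 b^2 - (a -
   b)^2 = (a + b)^2 >= 0]. *)
have := mulr_ge0 d0 (sqr_ge0 (f i 0 + f j 0 - 2 * m i)); nra.
Qed.

(** The squared norm of [P ^+ T *m f] is nonincreasing and bounded below, so its decrements, which
    dominate the squared differences, vanish in the limit. The bound on [P i i] excludes periodic
    oscillation. *)
Lemma power_diff_cvg0 (d : R) (f : 'cV[R]_n) i j :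
    0 < d -> i != j -> d <= P i i -> d <= P i j ->
  ((fun T => ((P ^+ T) *m f) i 0 - ((P ^+ T) *m f) j 0) @ \oo --> 0)%classic.
Proof.
move=> d0 ij dii dij.
pose g T := (P ^+ T) *m f.
pose N T := \sum_k g T k 0 ^+ 2.
have gS T : g T.+1 = P *m g T by rewrite /g exprS mulmxA.
have step T : d / 2 * (g T i 0 - g T j 0) ^+ 2 <= N T - N T.+1.
  have := sqnorm_decrement (g T) (ltW d0) ij dii dij; rewrite /N gS; lra.
have N_cvg : cvgn N.
  apply: nonincreasing_is_cvgn.
    apply/nonincreasing_seqP => T.
    have := step T; have := sqr_ge0 (g T i 0 - g T j 0); nra.
  by exists 0 => _ [T _ <-]; apply: sumr_ge0 => k _; rewrite sqr_ge0.
have dN_cvg : ((fun T => N T - N T.+1) @ \oo --> 0)%classic.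
  have NS_cvg : ((fun T => N T.+1) @ \oo --> limn N)%classic.
    by rewrite (cvg_shiftS N).
  by rewrite -(subrr (limn N)); exact: (cvgB N_cvg NS_cvg).
have sq_cvg : ((fun T => (g T i 0 - g T j 0) ^+ 2) @ \oo --> 0)%classic.
  apply: (@squeeze_cvgr _ _ _ _ (fun=> 0) (fun T => 2 / d * (N T - N T.+1))).
  - apply: nearW => T; rewrite sqr_ge0 /=.
    have := step T; rewrite -(ler_pM2l (_ : 0 < 2 / d)) ?divr_gt0//.
    apply: le_trans; rewrite le_eqVlt; apply/orP; left; apply/eqP.
    by field; rewrite gt_eqF.
  - exact: cvg_cst.
  - rewrite -(mulr0 (2 / d)); exact: (cvgM (cvg_cst _) dN_cvg).
have := cvg_comp _ _ sq_cvg (@sqrt_continuous R 0).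
rewrite sqrtr0 => sqrt_cvg; apply/norm_cvg0P.
by under eq_fun do rewrite -sqrtr_sqr.
Qed.

(** Away from [v] this is the first-step equation. The entry at [v] follows from conservation of the
    total: the other [n - 1] entries each lose 1, so [v] receives [n - 1]. *)
Lemma hitting_poisson v (h : 'cV[R]_n) :
    h v 0 = 0 -> (forall u, u != v -> h u 0 = 1 + \sum_w P u w * h w 0) ->
  P *m h = h - const_mx 1 + n%:R *: delta_mx v 0.
Proof.
move=> hv hu.
have Phu u : u != v -> (P *m h) u 0 = h u 0 - 1.
  by move=> uv; rewrite hu// mxE; lra.
have sumPh : \sum_u (P *m h) u 0 = \sum_u h u 0.
  under eq_bigr do rewrite mxE.
  rewrite exchange_big /=; apply: eq_bigr => w _.
  by rewrite -mulr_suml; under eq_bigr do rewrite P_sym; rewrite P_sum1 mul1r.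
have Phv : (P *m h) v 0 = n%:R - 1.
  move: sumPh; rewrite (bigD1 v)//= [RHS](bigD1 v)//= hv add0r.
  rewrite (eq_bigr (fun u => h u 0 - 1)) => [|u /Phu//].
  have -> : n%:R = n.-1%:R + 1 :> R.
    by rewrite natr1 prednK// (leq_ltn_trans _ (ltn_ord v)).
  by rewrite sumrB sumr_const cardC1 card_ord; lra.
apply/colP => u; have [->|uv] := eqVneq u v.
  by rewrite Phv !mxE !eqxx hv /=; ring.
by rewrite Phu// !mxE (negbTE uv) /=; ring.
Qed.

Lemma power_const1 T : P ^+ T *m const_mx 1 = const_mx 1 :> 'cV[R]_n.
Proof.
elim: T => [|T IH]; first by rewrite expr0 mul1mx.
rewrite exprSr -mulmxA -[RHS]IH; congr (_ *m _).
apply/colP => i; rewrite !mxE -[RHS](P_sum1 i); apply: eq_bigr => j _.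
by rewrite mxE mulr1.
Qed.

(** The term [T%:R] comes from [P] fixing constants; it does not depend on [i], so it cancels in
    differences. *)
Lemma poisson_telescope v (h : 'cV[R]_n) T i :
    P *m h = h - const_mx 1 + n%:R *: delta_mx v 0 ->
  h i 0 = (P ^+ T *m h) i 0 + T%:R - n%:R * \sum_(0 <= t < T) (P ^+ t) i v.
Proof.
move=> Ph; elim: T => [|T IH].
  by rewrite expr0 mul1mx big_geq// mulr0 subr0 addr0.
rewrite IH exprSr -mulmxA Ph mulmxDr mulmxBr power_const1 -scalemxAr.
rewrite big_nat_recr//= -colE !mxE -natr1; ring.
Qed.

(** For each [T] the left side is at most an error, the differences of [P ^+ T *m h], plus
    [n%:R * B]; the error tends to 0. Bounding partial sums by [B] keeps the argument in [R]. *)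
Lemma sum_hitting_diff_le (Q : rel 'I_n) (d B : R) v (h : 'cV[R]_n) :
    0 < d ->
    (forall i j, Q i j -> [/\ i != j, d <= P i i & d <= P i j]) ->
    P *m h = h - const_mx 1 + n%:R *: delta_mx v 0 ->
    (forall T, \sum_(0 <= t < T) \sum_i \sum_(j | Q i j)
       `|(P ^+ t) i v - (P ^+ t) j v| <= B) ->
  \sum_i \sum_(j | Q i j) `|h i 0 - h j 0| <= n%:R * B.
Proof.
move=> d0 PQ Ph PB.
pose D T i j := (P ^+ T *m h) i 0 - (P ^+ T *m h) j 0.
have D_cvg : ((fun T => \sum_i \sum_(j | Q i j) `|D T i j| + n%:R * B) @ \oo
    --> (\sum_i \sum_(j | Q i j) 0 : R) + n%:R * B)%classic.
  apply: cvgD; last exact: cvg_cst.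
  apply: cvg_big => [|i _]; first exact: add_continuous.
  apply: cvg_big => [|j Qij]; first exact: add_continuous.
  have [ij dii dij] := PQ _ _ Qij.
  exact/norm_cvg0P/(power_diff_cvg0 h d0 ij dii dij).
have <- : \sum_i \sum_(j | Q i j) 0 + n%:R * B = n%:R * B.
  by rewrite big1 ?add0r// => i _; rewrite big1.
apply: cvgr_to_ge D_cvg _.
apply: nearW => T.
apply: (@le_trans _ _ (\sum_i \sum_(j | Q i j) `|D T i j| + n%:R *
  \sum_(0 <= t < T) \sum_i \sum_(j | Q i j) `|(P ^+ t) i v - (P ^+ t) j v|)).
  2: by rewrite lerD2l ler_wpM2l.
rewrite exchange_big /= mulr_sumr -big_split /=; apply: ler_sum => i _.
rewrite exchange_big /= mulr_sumr -big_split /=; apply: ler_sum => j _.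
rewrite (poisson_telescope T i Ph) (poisson_telescope T j Ph).
set a := \sum_(0 <= t < T) _; set b := \sum_(0 <= t < T) _.
have -> : (P ^+ T *m h) i 0 + T%:R - n%:R * a
        - ((P ^+ T *m h) j 0 + T%:R - n%:R * b)
        = D T i j - n%:R * (a - b) by rewrite /D; ring.
apply: (le_trans (ler_normB _ _)); rewrite lerD2l normrM normr_nat ler_wpM2l//.
by rewrite /a /b -sumrB ler_norm_sum.
Qed.

End SymmetricChain.

(** * The symmetric walk, its rotor lengths, and the weighted sum in K' *)

Section SymWalk.
Variables (R : realType) (n : nat) (e : rel 'I_n).
Hypotheses (e_sym : symmetric e) (e_irr : irreflexive e).

Let D := max_deg e.
Let P := sym_walk R e.

Lemma deg_le_max u : (deg e u <= max_deg e)%N.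
Proof. exact: (@leq_bigmax _ (deg e)). Qed.

Lemma deg_sum u : (deg e u)%:R = \sum_w (e u w)%:R :> R.
Proof.
rewrite /deg cardsE -sum1_card natr_sum big_mkcond /=.
by apply: eq_bigr => w _; rewrite unfold_in; case: (e u w).
Qed.

(** A form without conditionals, to be summed term by term; irreflexivity makes the two cases
    exclusive. *)
Lemma sym_walkE u w : P u w =
  (e u w)%:R / D.+1%:R + (u == w)%:R * (1 - (deg e u)%:R / D.+1%:R).
Proof.
rewrite mxE -/D; case: (boolP (e u w)) => [euw|_].
  case: eqP euw => [->|_ _]; first by rewrite e_irr.
  by rewrite mul1r mul0r addr0.
by case: (u == w); rewrite ?mul1r ?mul0r ?add0r.
Qed.

(** Normalising by the maximum degree plus one leaves each vertex a holding probability no smaller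
    than that of an edge. *)
Lemma sym_walk_diag_ge u : D.+1%:R^-1 <= P u u.
Proof.
rewrite sym_walkE e_irr eqxx mul0r add0r mul1r lerBrDr.
rewrite -[X in X + _]mul1r -mulrDl.
by rewrite ler_pdivrMr ?ltr0n// mul1r nat1r ler_nat ltnS deg_le_max.
Qed.

Lemma sym_walk_edge u w : e u w -> P u w = D.+1%:R^-1.
Proof. by move=> euw; rewrite mxE euw. Qed.

Lemma sym_walk_ge0 u w : 0 <= P u w.
Proof.
have [->|uw] := eqVneq u w; first by rewrite (le_trans _ (sym_walk_diag_ge w)).
by rewrite sym_walkE (negbTE uw) mul0r addr0 divr_ge0.
Qed.

Lemma sum_delta (u : 'I_n) : \sum_w (u == w)%:R = 1 :> R.
Proof.
rewrite (bigD1 u)//= eqxx big1 ?addr0// => w.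
by rewrite eq_sym => /negbTE ->.
Qed.

Lemma sym_walk_sum1 u : \sum_w P u w = 1.
Proof.
under eq_bigr do rewrite sym_walkE.
by rewrite big_split /= -!mulr_suml -deg_sum sum_delta mul1r subrKC.
Qed.

Lemma sym_walk_sym u w : P u w = P w u.
Proof.
have [->//|uw] := eqVneq u w.
by rewrite !sym_walkE e_sym [w == u]eq_sym (negbTE uw) !mul0r.
Qed.

(** Relates the ordered pairs summed in K' to the edges, counted once each, in [walk_Psi]. *)
Lemma sum_edges_split (F : 'I_n -> 'I_n -> R) : (forall i j, F i j = F j i) ->
  \sum_i \sum_j (e i j)%:R * F i j
    = 2 * \sum_(i < n) \sum_(j < n | (i < j)%N && e i j) F i j.
Proof.
move=> F_sym.
have ltF (i : 'I_n) : \sum_(j < n | (i < j)%N && e i j) F i j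
    = \sum_(j < n) (i < j)%N%:R * ((e i j)%:R * F i j).
  rewrite big_mkcond; apply: eq_bigr => j _.
  by case: (i < j)%N; case: (e i j); rewrite ?mul1r ?mul0r.
under [in RHS]eq_bigr do rewrite ltF.
rewrite mulr_natl mulr2n [X in _ = _ + X]exchange_big -big_split /=.
apply: eq_bigr => i _; rewrite -big_split; apply: eq_bigr => j _ /=.
rewrite [e j i]e_sym [F j i]F_sym -mulrDl.
case: (ltngtP i j) => [_|_|/val_inj ->]; rewrite ?addr0 ?add0r ?mul1r//.
by rewrite e_irr !mul0r.
Qed.

Variable s : 'I_n -> seq 'I_n.
Hypothesis s_rotor : unweighted_rotor e s.

Let k u : R := (size (s u))%:R / (deg e u)%:R.
Let kappa : R := rotor_kappa R e s.
Let d u := size (sym_rotor e s u).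

(** The count of any neighbour is the exact quotient of [size (s u)] by [deg e u]. At an isolated
    vertex the rotor is empty and division by zero yields 0 on both sides. *)
Lemma size_sym_rotor u : (d u)%:R = D.+1%:R * k u.
Proof.
have [s_nbr s_count _] := s_rotor u.
rewrite /d /sym_rotor size_cat size_nseq /k.
have [deg0|deg_gt0] := posnP (deg e u).
  have -> : s u = [::].
    apply/eqP; apply: contraT; case: (s u) s_nbr => // w r /(_ w).
    rewrite mem_head => /(_ isT) euw _.
    by move: deg0; rewrite /deg => /cards0_eq/setP/(_ w); rewrite !inE euw.
  by rewrite /sym_rotor_length deg0 divn0 sub0n !mul0r mulr0.
have [w euw] : exists w, e u w.
  by move: deg_gt0; rewrite /deg => /card_gt0P[w]; rewrite inE; exists w.
rewrite /sym_rotor_length -/D -(s_count w euw) mulnA mulnK//.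
rewrite subnKC; last by rewrite mulnC leq_mul2r ltnW ?orbT// ltnS deg_le_max.
by rewrite !natrM mulfK// pnatr_eq0 -lt0n.
Qed.

Lemma rotor_ratio_ge0 u : 0 <= k u.
Proof. exact: divr_ge0. Qed.

Lemma rotor_ratio_le u : k u <= kappa.
Proof. exact: (le_bigmax _ k). Qed.

Lemma rotor_kappa_ge0 : 0 <= kappa.
Proof. by apply: bigmax_ge_id. Qed.

(** If [u] has a neighbour then [D >= 1], hence [D + 1 <= 2 D]; otherwise the length is 0. *)
Lemma size_sym_rotor_le u : (d u)%:R <= 2 * D%:R * kappa.
Proof.
rewrite size_sym_rotor; have [deg0|deg_gt0] := posnP (deg e u).
  by rewrite /k deg0 invr0 !mulr0 !mulr_ge0 ?rotor_kappa_ge0.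
have D1 : 1 <= D%:R :> R by rewrite ler1n (leq_trans deg_gt0)// deg_le_max.
apply: ler_pM; rewrite ?rotor_ratio_ge0 ?rotor_ratio_le//.
by rewrite -natr1; lra.
Qed.

(** The 3 is 1 from the [- 1] inside the absolute value, summed over edges with total degree at most
    [n D], plus 2 from the diagonal terms. *)
Lemma weighted_diff_le (h : 'I_n -> R) :
  \sum_i \sum_j (d i)%:R * P i j * `|h i - h j - 1|
    <= kappa * (2 * \sum_(i < n) \sum_(j < n | (i < j)%N && e i j) `|h i - h j|)
       + 3 * (n%:R * D%:R * kappa).
Proof.
have termle i j : (d i)%:R * P i j * `|h i - h j - 1| <=
    kappa * ((e i j)%:R * `|h i - h j|) + kappa * (e i j)%:R
    + (i == j)%:R * (2 * D%:R * kappa).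
  have [->|ij] := eqVneq i j.
    rewrite e_irr mul0r !mulr0 !add0r mul1r subrr add0r normrN1 mulr1.
    rewrite (le_trans _ (size_sym_rotor_le j))// ler_piMr//.
    rewrite -[leRHS](sym_walk_sum1 j) (bigD1 j)//= lerDl sumr_ge0// => w _.
    exact: sym_walk_ge0.
  rewrite mul0r addr0; case: (boolP (e i j)) => [eij|neij]; last first.
    by rewrite sym_walkE (negbTE ij) (negbTE neij) !mul0r addr0
      mulr0 mul0r mulr0 addr0.
  (* The factor [D.+1] in the rotor length cancels the edge probability, leaving [k i]. *)
  rewrite sym_walk_edge// size_sym_rotor [X in X * _]mulrAC mulfV ?pnatr_eq0//.
  rewrite !mul1r -mulrDr ler_pM ?rotor_ratio_ge0 ?rotor_ratio_le//.
  by rewrite (le_trans (ler_normB _ _))// normr1.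
apply: (@le_trans _ _ (\sum_i \sum_j (kappa * ((e i j)%:R * `|h i - h j|)
    + kappa * (e i j)%:R + (i == j)%:R * (2 * D%:R * kappa)))).
  by apply: ler_sum => i _; apply: ler_sum => j _; exact: termle.
rewrite -(sum_edges_split (F := fun i j => `|h i - h j|)); last first.
  by move=> i j; rewrite distrC.
under eq_bigr => i _.
  rewrite !big_split /= -!mulr_sumr -deg_sum -mulr_suml sum_delta; over.
rewrite !big_split /= -!mulr_sumr sumr_const card_ord -addrA lerD2l mul1r.
have : kappa * \sum_i (deg e i)%:R <= kappa * (n%:R * D%:R).
  rewrite ler_wpM2l ?rotor_kappa_ge0//.
  rewrite -[X in X%:R * _]card_ord mulr_natl -sumr_const; apply: ler_sum => i _.
  by rewrite ler_nat deg_le_max.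
rewrite -[_ *+ n]mulr_natl; lra.
Qed.

End SymWalk.

Theorem theorem3p8 (R : realType) :
  exists C : R, 0 < C /\
    forall (n : nat) (e : rel 'I_n) (s : 'I_n -> seq 'I_n),
      symmetric e -> irreflexive e -> connected_graph e ->
      unweighted_rotor e s ->
      forall v : 'I_n,
        (walk_K (sym_walk R e) (@sym_stationary R n)
           (fun u => size (sym_rotor e s u)) v
         <= C%:E * (max_hitting_time (sym_walk R e) v
                    + (rotor_kappa R e s / sym_stationary R v)%:E
                      * walk_Psi e (sym_walk R e) v
                    + (n%:R * (max_deg e)%:R * rotor_kappa R e s)%:E))%E.
Proof.
(* The largest coefficient needed is 5/2, on the last term: 1 from the rotor length at [v] and 3/2
   from half the weighted sum. *)
exists 3; split=> // n e s e_sym e_irr _ s_rotor v.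
set P := sym_walk R e; set kappa := rotor_kappa R e s.
set M := max_hitting_time P v; set Psi := walk_Psi e P v.
pose d u := size (sym_rotor e s u).
have P_ge0 := sym_walk_ge0 R e_irr; have P_sum1 := sym_walk_sum1 R e_irr.
have P_sym := sym_walk_sym R e_sym e_irr.
have kappa_ge0 : 0 <= kappa := rotor_kappa_ge0 R e s.
have H_le u : (hitting_time P u v <= M)%E by exact: (le_bigmax _ _ u).
have M_ge0 : (0 <= M)%E by rewrite (le_trans _ (H_le v))// hitting_time_ge0.
have term_ge0 t : 0 <= \sum_(i < n) \sum_(j < n | (i < j)%N && e i j)
    `|(P ^+ t) i v - (P ^+ t) j v|.
  by apply: sumr_ge0 => i _; apply: sumr_ge0.
have Psi_ge0 : (0 <= Psi)%E by apply: nneseries_ge0 => t _ _; rewrite lee_fin.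
have d_le u := size_sym_rotor_le R s_rotor u.
have tail_ge0 : 0 <= n%:R * (max_deg e)%:R * kappa by rewrite !mulr_ge0.
have n_gt0 : 0 < n%:R :> R by rewrite ltr0n (leq_ltn_trans _ (ltn_ord v)).
(* Treated apart because [0 * +oo = 0]: an infinite [Psi] makes the right side infinite only when
   [kappa > 0]. Here K' reduces to [M]. *)
have [kappa0|kappa_neq0] := eqVneq kappa 0.
  have d0 u : (d u)%:R = 0 :> R.
    apply/eqP; rewrite eq_le ler0n andbT (le_trans (d_le u))//.
    by rewrite -/kappa kappa0 mulr0.
  rewrite /walk_K d0 mul0r big1 => [|i _]; last first.
    by rewrite big1// => j _; rewrite d0 mul0r mul0e.
  rewrite kappa0 !mul0r mul0e mulr0 !adde0 mule0 adde0 -/M.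
  by rewrite lee_pemull// lee_fin ler1n.
have kappa_gt0 : 0 < kappa by rewrite lt_def kappa_neq0.
have [->|M_neq] := eqVneq M +oo%E.
  rewrite addye; last first.
    rewrite gt_eqF// (lt_le_trans ltNy0)// mule_ge0// lee_fin.
    by rewrite divr_ge0// invr_ge0.
  by rewrite addye// gt0_muley ?lte_fin// leey.
have [->|Psi_neq] := eqVneq Psi +oo%E.
  rewrite gt0_muley ?lte_fin ?divr_gt0 ?invr_gt0//.
  rewrite addey; last by rewrite gt_eqF// (lt_le_trans ltNy0).
  by rewrite addye// gt0_muley ?lte_fin// leey.
have M_fin : M \is a fin_num by rewrite ge0_fin_numE// ltey.
have Psi_fin : Psi \is a fin_num by rewrite ge0_fin_numE// ltey.
have H_lt u : (hitting_time P u v < +oo)%E.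
  by rewrite (le_lt_trans (H_le u))// ltey.
pose h : 'cV[R]_n := \col_u fine (hitting_time P u v).
have HE u : hitting_time P u v = (h u 0)%:E.
  by rewrite mxE fineK// ge0_fin_numE// hitting_time_ge0.
have Ph : P *m h = h - const_mx 1 + n%:R *: delta_mx v 0.
  apply: hitting_poisson => //.
    by apply: EFin_inj; rewrite -HE hitting_time_refl.
  move=> u uv; apply: EFin_inj; rewrite -HE hitting_time_rec// EFinD -sumEFin.
  by congr (_ + _)%E; apply: eq_bigr => w _; rewrite HE.
have edge_le : \sum_(i < n) \sum_(j < n | (i < j)%N && e i j) `|h i 0 - h j 0|
    <= n%:R * fine Psi.
  (* The edge probability also bounds the diagonal from below, so it serves as [d]. *)
  apply: (@sum_hitting_diff_le _ _ P P_ge0 P_sum1 P_sym _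
    (max_deg e).+1%:R^-1) Ph _.
  - by rewrite invr_gt0.
  - move=> i j /andP[ij eij]; split; first by rewrite neq_ltn ij.
      exact: sym_walk_diag_ge.
    by rewrite sym_walk_edge.
  - move=> T; rewrite -lee_fin fineK// -sumEFin.
    by apply: nneseries_lim_ge => t _ _; rewrite lee_fin.
rewrite /walk_K -/M.
under eq_bigr do under eq_bigr do rewrite !HE -!EFinB abse_EFin -EFinM.
under eq_bigr do rewrite sumEFin.
rewrite sumEFin -(fineK M_fin) -(fineK Psi_fin) -!EFinM -!EFinD lee_fin.
have := weighted_diff_le e_sym e_irr s_rotor (fun i => h i 0).
have := ler_wpM2l kappa_ge0 edge_le; have := ler_wpM2l (ltW n_gt0) (d_le v).
have := fine_ge0 M_ge0.
have := mulr_ge0 kappa_ge0 (mulr_ge0 (ltW n_gt0) (fine_ge0 Psi_ge0)).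
rewrite /sym_stationary !invrK -/P -/kappa; lra.
Qed.
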